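(* Let $G$ be a simple graph and let $K_{s_1},K_{s_2},\ldots,K_{s_k}$ be pairwise edge-disjoint cliques (complete subgraphs) of $G$ with $s_i\ge 3$ for all $i$. Then $G$ has at least $\sum_{i=1}^{k}\frac{\binom{s_i}{3}}{1+3(s_i-3)}$ $\mathcal{H}$-eigenvalues (counted with multiplicity) not less than $3$.
   Context: For an oriented edge $e$ write $e^-$ for its tail and $e^+$ for its head. For distinct edges $e,e'$: $e\leftrightarrow e'$ means $e^+=e'^-$ or $e'^+=e^-$; $e\overset{\pm}{\sim}e'$ means $e^+=e'^+$ or $e^-=e'^-$; $e\vartriangle e'$ means $e,e'$ are two edges of a common triangle. $\triangle(e)$ is the number of triangles containing $e$. The Helmholtzian matrix $\mathcal{H}(G)=(h_{ee'})$ is indexed by edges, with $h_{ee}=\triangle(e)+2$, and for $e\ne e'$: $h_{ee'}=-1$ if $e\leftrightarrow e'$ and not $e\vartriangle e'$; $h_{ee'}=1$ if $e\overset{\pm}{\sim}e'$ and not $e\vartriangle e'$; $h_{ee'}=0$ otherwise. The $\mathcal{H}$-eigenvalues of $G$ are the eigenvalues of $\mathcal{H}(G)$ for an arbitrary edge orientation (independent of the orientation). *)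

(* Defs.v *)
From HB Require Import structures.
From mathcomp Require Import all_boot all_order all_algebra all_field.
Set Implicit Arguments. Unset Strict Implicit. Unset Printing Implicit Defensive.
Import Order.TTheory GRing.Theory Num.Theory.

Definition simple_graph (V : finType) (adj : rel V) : Prop :=
  irreflexive adj /\ symmetric adj.

Definition orientation (V : finType) (adj o : rel V) : Prop :=
  (forall u v, o u v -> adj u v) /\
  (forall u v, adj u v -> o u v || o v u) /\
  (forall u v, o u v -> ~~ o v u).

Definition oedge (V : finType) (o : rel V) := {p : V * V | o p.1 p.2}.

Local Open Scope ring_scope.
Section Helm.
Variables (V : finType) (adj o : rel V).
Local Notation E := (oedge o).

Definition tl (e : E) : V := (val e).1.
Definition hd (e : E) : V := (val e).2.

Definition ntri (e : E) : nat := #|[set w | adj w (tl e) && adj w (hd e)]|.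

Definition headtail (e e' : E) : bool := (hd e == tl e') || (hd e' == tl e).
Definition samedir (e e' : E) : bool := (hd e == hd e') || (tl e == tl e').

Definition in_tri (e e' : E) : bool :=
  (e != e') && [exists w : V,
     (adj (tl e) (hd e) && adj (hd e) w && adj w (tl e)) &&
     ((val e' \in [:: (hd e, w); (w, hd e); (w, tl e); (tl e, w)]))].

Definition helm_entry (e e' : E) : int :=
  if e == e' then Posz (ntri e + 2)
  else if headtail e e' && ~~ in_tri e e' then (-1)%R
  else if samedir e e' && ~~ in_tri e e' then 1%R
  else 0%R.

Definition helmholtzian : 'M[algC]_#|{: E}| :=
  \matrix_(i, j) ((helm_entry (enum_val i) (enum_val j))%:~R).
End Helm.

Definition is_clique (V : finType) (adj : rel V) (S : {set V}) : Prop :=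
  forall u v, u \in S -> v \in S -> u != v -> adj u v.

(* Main.v *)
(* The Helmholtzian is B^T B + C^T C, where B is the vertex-edge incidence matrix
   and the rows of C are the signed indicator vectors c_T of the triangles T.
   In each clique K_s, a maximal family of pairwise edge-disjoint triangles has at
   least C(s,3) / (1 + 3(s-3)) members, since a triangle shares an edge with only
   3(s-3) others.  If Q is the union of these families, the c_T with T in Q are
   orthogonal of squared norm 3, so for u = sum_(T in Q) a_T c_T one gets
   <u, Hu> >= sum_(T in Q) <u, c_T>^2 = 9 |a|^2 = 3 |u|^2.  A form bounded below by
   3 on a space of dimension #|Q| has at least #|Q| eigenvalues >= 3. *)

Require Import Defs.
From HB Require Import structures.
From mathcomp Require Import all_boot all_order all_algebra all_field.
From mathcomp Require Import zify ring.
Set Implicit Arguments. Unset Strict Implicit.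
Import Order.TTheory GRing.Theory Num.Theory.
Local Open Scope ring_scope.

(** * Counting eigenvalues above a bound from a quadratic form *)

Section Spectral.
Local Open Scope sesquilinear_scope.

Lemma char_poly_conj (R : comUnitRingType) n (P A : 'M[R]_n) :
  P \in unitmx -> char_poly (invmx P *m A *m P) = char_poly A.
Proof.
move=> Pu; rewrite /char_poly /char_poly_mx.
have VP : map_mx polyC (invmx P) *m map_mx polyC P = 1%:M.
  by rewrite -map_mxM mulVmx ?map_mx1.
have -> : 'X%:M - map_mx polyC (invmx P *m A *m P) =
    map_mx polyC (invmx P) *m ('X%:M - map_mx polyC A) *m map_mx polyC P.
  by rewrite mulmxBr mulmxBl !map_mxM mul_mx_scalar -scalemxAl VP scalemx1.
by rewrite !det_mulmx mulrAC -det_mulmx VP det1 mul1r.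
Qed.

(** One half of the min-max principle, by a dimension count: projecting the row space of [W] onto
    the span of the eigenvectors with eigenvalue at least [c] is injective, so that span has
    dimension at least [m]. *)
Lemma leq_count_eigenvalue_ge (C : numClosedFieldType) m n (A : 'M[C]_n)
    (W : 'M[C]_(m, n)) (c : C) (rs : seq C) :
  c \is Num.real -> A \is hermsymmx -> row_free W ->
  (forall u : 'rV_n, (u <= W)%MS ->
     c * (u *m u^t*) 0 0 <= (u *m A *m u^t*) 0 0) ->
  char_poly A = \prod_(r <- rs) ('X - r%:P) ->
  (m <= count (fun r => (c <= r)%R) rs)%N.
Proof.
move=> cR hermA freeW geW charA.
have normA := hermitian_normalmx hermA.
have dR := hermitian_spectral_diag_real hermA.
have /orthomx_spectralP defA := normA.
set P := spectralmx A in defA; set d := spectral_diag A in defA dR.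
have uP : P \is unitarymx by apply: spectral_unitarymx.
have Pu : P \in unitmx by apply: spectral_unit.
have perm_rs : perm_eq rs [seq d 0 i | i <- enum 'I_n].
  apply: prod_XsubC_eq; rewrite -charA defA char_poly_conj //.
  rewrite char_poly_trig ?diag_mx_is_trig // big_map big_enum /=.
  by apply: eq_bigr => i _; rewrite !mxE eqxx mulr1n.
pose J := [pred i | c <= d 0 i].
have -> : count (fun r => (c <= r)%R) rs = #|J|.
  by rewrite (permP perm_rs) count_map cardE [in RHS]/enum_mem size_filter enumT.
(* Row [i] of [M] holds the coordinates of row [i] of [W] along the eigenvectors indexed by [J]; [M]
   has [#|J|] columns, so its freeness gives the bound. *)
pose M := colsub (@enum_val _ J) (W *m P^t*).
(* A vector of the row space of [W] orthogonal to all eigenvectors with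
   eigenvalue at least [c] vanishes. *)
suff freeM : row_free M by rewrite -(eqP freeM) rank_leq_col.
apply: inj_row_free => y yM0.
pose v := y *m (W *m P^t*).
have vJ0 i : c <= d 0 i -> v 0 i = 0.
  move=> Ji; have -> : v 0 i = (y *m M) 0 (enum_rank_in Ji i).
    by rewrite /v !mxE; apply: eq_bigr => k _; rewrite [in RHS]mxE enum_rankK_in.
  by rewrite yM0 mxE.
have defyW : y *m W = v *m P by rewrite /v !mulmxA mulmxKtV.
have := geW (y *m W) (submxMl _ _).
rewrite defyW trmx_mul map_mxM !mulmxA mulmxtVK // {1}defA !mulmxA.
rewrite mulmxK // mulmxtVK // mul_mx_diag !mxE mulr_sumr => le_sum.
(* Either [c <= d 0 j] and the coordinate is zero, or the factor [c - d 0 j] is positive. Since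
   [le_sum] makes the total nonpositive, every term vanishes. *)
have term_ge0 j : 0 <= (c - d 0 j) * `|v 0 j| ^+ 2.
  have dj : d 0 j \is Num.real by apply: (mxOverP dR).
  have [/vJ0->|ltdc] := real_leP cR dj; first by rewrite normr0 expr0n mulr0.
  by rewrite mulr_ge0 ?exprn_ge0 // subr_ge0 ltW.
have sum0 : \sum_j (c - d 0 j) * `|v 0 j| ^+ 2 = 0.
  apply/le_anti; rewrite sumr_ge0 // andbT; move: le_sum; rewrite -subr_le0 -sumrB.
  congr (_ <= _); apply: eq_bigr => j _; rewrite !mxE normCK; ring.
suff v0 : v = 0.
  apply/eqP; rewrite -(mulmx_free_eq0 _ freeW) defyW v0 mul0mx; exact: eqxx.
apply/rowP => j; rewrite [RHS]mxE; have [/vJ0 ->//|/negP Nle] := boolP (c <= d 0 j).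
have /eqP := psumr_eq0P (fun j _ => term_ge0 j) sum0 (i := j) isT.
rewrite mulf_eq0 expf_eq0 normr_eq0 subr_eq0 /= => /predU1P[cd|/eqP//].
by case: Nle; rewrite cd.
Qed.
End Spectral.

(** * Packing triples that pairwise share at most one point *)

Lemma card_triples_meeting (V : finType) (S B : {set V}) :
  B \subset S -> #|B| = 3%N ->
  (#|[set A : {set V} | [&& A \subset S, #|A| == 3 & 1 < #|A :&: B| ]]|
     <= 1 + 3 * (#|S| - 3))%N.
Proof.
move=> sBS cB.
(* A triple meeting [B] in two points is [B] with one point exchanged. *)
pose f (p : V * V) := p.2 |: B :\ p.1.
(* The 1 stands for [B] itself, the product for the pairs of a point leaving [B] and a point of [S]
   outside [B] replacing it. *)
have -> : (1 + 3 * (#|S| - 3))%N = (#|[set B]| + #|setX B (S :\: B)|)%N.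
  by rewrite cards1 cardsX cardsD (setIidPr sBS) cB.
apply: leq_trans (leq_add (leqnn _) (leq_imset_card f _)).
apply: leq_trans (leq_card_setU _ _).
apply/subset_leq_card/subsetP => A; rewrite !inE => /and3P[sAS /eqP cA cAB].
have [//|neAB] := eqVneq A B; apply/imsetP.
have cABlt : (#|A :&: B| < 3)%N.
  rewrite -cA ltn_neqAle subset_leq_card ?subsetIl // andbT.
  apply: contra neAB => /eqP/eqP; rewrite eq_sym => /eqP cAB3.
  have /eqP/setIidPl sAB : A :&: B == A by rewrite eqEcard subsetIl cAB3 leqnn.
  by rewrite eqEcard sAB cA cB.
have cI : #|A :&: B| = 2%N by lia.
have : #|A :\: B| = 1%N by rewrite cardsD cI cA.
have : #|B :\: A| = 1%N by rewrite cardsD setIC cI cB.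
move=> /eqP/cards1P[b bP] /eqP/cards1P[a aP].
exists (b, a).
  have: b \in B :\: A by rewrite bP set11.
  have: a \in A :\: B by rewrite aP set11.
  rewrite !inE => /andP[aB aA] /andP[_ ->] /=.
  by rewrite aB (subsetP sAS).
by rewrite /f /= -aP -bP setDDr setDv set0U setUC setIC setID.
Qed.

(** Take a packing maximal for inclusion. Every triple of [S] meets some member in two points, so
    the sets [near B] cover all triples, and [card_triples_meeting] bounds each of them. *)
Lemma ex_triple_packing (V : finType) (S : {set V}) :
  exists P : {set {set V}},
    [/\ forall A, A \in P -> A \subset S /\ #|A| = 3%N,
        forall A B, A \in P -> B \in P -> A != B -> (#|A :&: B| <= 1)%N
      & ('C(#|S|, 3) <= #|P| * (1 + 3 * (#|S| - 3)))%N].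
Proof.
pose D := [set A : {set V} | A \subset S & #|A| == 3].
pose packing (P : {set {set V}}) := (P \subset D) &&
  [forall A in P, forall B in P, (A != B) ==> (#|A :&: B| <= 1)%N].
have [|P /maxsetP[/andP[/subsetP sPD disjP] maxP]] := @ex_maxset _ packing.
  exists set0; rewrite /packing sub0set /=.
  by apply/forall_inP => A; rewrite inE.
have disj A B : A \in P -> B \in P -> A != B -> (#|A :&: B| <= 1)%N.
  by move=> AP BP; apply/implyP/(forall_inP (forall_inP disjP A AP)).
exists P; split=> //.
  by move=> A /sPD; rewrite inE => /andP[-> /eqP].
rewrite -cards_draws -/D.
pose near B := [set A : {set V} | [&& A \subset S, #|A| == 3 & 1 < #|A :&: B| ]%N ].
have sD : D \subset \bigcup_(B in P) near B.
  (* A triple near no member could be added to [P], so by maximality it already lies in [P]; but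
     then it is near itself. *)
  apply/subsetP => A AD; apply: contraT => farA.
  have far B : B \in P -> (#|A :&: B| <= 1)%N.
    move=> BP; rewrite leqNgt; apply: contra farA => AB.
    by apply/bigcupP; exists B => //; move: AD; rewrite !inE AB andbT.
  have cA : #|A| = 3%N by move: AD; rewrite inE => /andP[_ /eqP].
  have AP : A \notin P by apply/negP => /far; rewrite setIid cA.
  case/negP: AP; rewrite -(maxP (A |: P)) ?setU11 ?subsetUr //.
  apply/andP; split; first by rewrite subUset sub1set AD; apply/subsetP.
  apply/forall_inP => B BU; apply/forall_inP => C CU; apply/implyP.
  case/setU1P: BU => [->|BP]; case/setU1P: CU => [->|CP].
  - by rewrite eqxx.
  - by move=> _; apply: far.
  - by move=> _; rewrite setIC; apply: far.
  - exact: disj.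
apply: leq_trans (subset_leq_card sD) _.
rewrite -sum_nat_const.
apply: (@leq_trans (\sum_(B in P) #|near B|)).
  elim/big_rec2: _ => [|B n U _ leUn]; first by rewrite cards0.
  by rewrite (leq_trans (leq_card_setU _ _)) ?leq_add2l.
apply: leq_sum => B /sPD; rewrite inE => /andP[sBS /eqP cB].
exact: card_triples_meeting.
Qed.

(** * Incidence and triangle boundary coefficients, and their Gram sums *)

Section Boundary.
Variables (V : finType) (adj o : rel V).
Hypotheses (Hg : simple_graph adj) (Ho : orientation adj o).
Local Notation E := (oedge o).

(* The coefficient of the oriented edge [p] in the 1-chain [uv]. *)
Definition arc_coef (p : V * V) (u v : V) : int :=
  (p == (u, v))%:R - (p == (v, u))%:R.

Definition tri_coef (p : V * V) (u v w : V) : int :=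
  arc_coef p u v + arc_coef p v w + arc_coef p w u.

Definition triangle (u v w : V) : bool := [&& adj u v, adj v w & adj w u].

(** The entry at [e] of the boundary vector of the oriented triangle [uvw]. It is defined on all
    ordered triples and zero on those that are not triangles, so that no orientation of the
    triangles has to be chosen; reordering the vertices changes at most the sign. *)
Definition tri_entry (u v w : V) (e : E) : int :=
  (triangle u v w)%:R * tri_coef (val e) u v w.

Definition div_entry (v : V) (e : E) : int := (hd e == v)%:R - (tl e == v)%:R.

Lemma adj_irr u : adj u u = false. Proof. by case: Hg => ->. Qed.

Lemma adj_sym u v : adj u v = adj v u. Proof. by case: Hg => _ ->. Qed.

Lemma oedge_adj (e : E) : adj (tl e) (hd e).
Proof. by case: Ho => oA _; apply: oA; apply: (valP e). Qed.

Lemma sum_eqM (T : finType) (a : T) (F : T -> int) :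
  \sum_x (a == x)%:R * F x = F a.
Proof.
rewrite (bigD1 a) //= eqxx mul1r big1 ?addr0 // => x /negPf.
by rewrite eq_sym => ->; rewrite mul0r.
Qed.

Lemma sum_arc_coef (p : V * V) (F : V -> V -> int) :
  \sum_u \sum_v arc_coef p u v * F u v = F p.1 p.2 - F p.2 p.1.
Proof.
rewrite pair_big /=.
under eq_bigr => q _ do rewrite mulrBl.
rewrite sumrB; congr (_ - _).
  rewrite -[RHS](sum_eqM p (fun q => F q.1 q.2)).
  by apply: eq_bigr => -[].
rewrite -[RHS](sum_eqM (p.2, p.1) (fun q => F q.1 q.2)).
apply: eq_bigr => -[u v] _ /=; case: p => a b /=.
by rewrite !xpair_eqE andbC.
Qed.

Lemma triangle_cycle u v w : triangle v w u = triangle u v w.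
Proof. by rewrite /triangle andbA andbC. Qed.

Lemma triangle_swap u v w : triangle v u w = triangle u v w.
Proof.
by rewrite /triangle (adj_sym v u) (adj_sym u w) (adj_sym w v); congr (_ && _); rewrite andbC.
Qed.

Lemma tri_entry_cycle u v w e : tri_entry v w u e = tri_entry u v w e.
Proof. by rewrite /tri_entry triangle_cycle /tri_coef; ring. Qed.

Lemma tri_entry_swap u v w e : tri_entry v u w e = - tri_entry u v w e.
Proof. by rewrite /tri_entry triangle_swap /tri_coef /arc_coef; ring. Qed.

(* Every triangle is counted 6 times on the left, once per ordering. *)
Lemma sum_tri_entryM (e e' : E) :
  \sum_u \sum_v \sum_w tri_entry u v w e * tri_entry u v w e' =
  6 * \sum_w tri_entry (tl e) (hd e) w e'.
Proof.
pose G u v w := tri_entry u v w e'.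
pose s (F : V -> V -> V -> int) := \sum_u \sum_v \sum_w F u v w.
have s_cycle F : s (fun u v w => F v w u) = s F.
  rewrite /s; under eq_bigr => u _ do rewrite exchange_big.
  rewrite exchange_big; under eq_bigr => w _ do rewrite exchange_big /=.
  rewrite exchange_big; apply: eq_bigr => v _.
  by rewrite exchange_big.
(* Only [(tl e, hd e)] and its reverse contribute, and they contribute equally because both
   [arc_coef] and [G] change sign under the swap. *)
have sE : s (fun u v w => arc_coef (val e) u v * G u v w) = 2 * \sum_w G (tl e) (hd e) w.
  rewrite /s; under eq_bigr => u _ do under eq_bigr => v _ do rewrite -mulr_sumr.
  rewrite (sum_arc_coef _ (fun u v => \sum_w G u v w)) -/(tl e) -/(hd e).
  under [X in _ - X]eq_bigr => w _ do rewrite /G tri_entry_swap.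
  rewrite sumrN /G; ring.
(* Since [G] is invariant under rotation, the three sides of the triangle give the same sum; this
   yields 6 as 3 times 2. *)
transitivity (s (fun u v w => arc_coef (val e) u v * G u v w) +
   s (fun u v w => arc_coef (val e) v w * G v w u) +
   s (fun u v w => arc_coef (val e) w u * G w u v)).
  rewrite /s -!big_split; apply: eq_bigr => u _; rewrite -!big_split.
  apply: eq_bigr => v _; rewrite -!big_split; apply: eq_bigr => w _ /=.
  rewrite /G (tri_entry_cycle u v w) -(tri_entry_cycle w u v).
  rewrite /tri_entry; case: (triangle u v w); rewrite ?mul0r ?mulr0 ?mul1r //.
  by rewrite -!mulrDl.
rewrite (s_cycle (fun u v w => arc_coef (val e) u v * G u v w)).
rewrite -(s_cycle (fun u v w => arc_coef (val e) w u * G w u v)).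
by rewrite sE; ring.
Qed.

Lemma sum_div_entryM (e e' : E) :
  \sum_v div_entry v e * div_entry v e' =
  (hd e == hd e')%:R + (tl e == tl e')%:R - (hd e == tl e')%:R - (tl e == hd e')%:R.
Proof.
under eq_bigr => v _ do rewrite mulrBl.
by rewrite sumrB !sum_eqM /div_entry !(eq_sym (hd e')) !(eq_sym (tl e')); ring.
Qed.

(** On the diagonal the incidence part gives 2 and the triangle part [ntri e]. For distinct edges
    with a common end the incidence part is the sign of the pair; if they lie in a common triangle,
    that triangle contributes the opposite sign and cancels it. *)
Lemma helm_entryE (e e' : E) :
  helm_entry adj e e' =
  \sum_v div_entry v e * div_entry v e' + \sum_w tri_entry (tl e) (hd e) w e'.
Proof.
pose T w := adj w (tl e) && adj w (hd e).
have adjE := oedge_adj e.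
have adjE' := oedge_adj e'.
have neq_e : (hd e == tl e) = false.
  by apply/negP => /eqP eq; rewrite eq adj_irr in adjE.
have neq_e' : (hd e' == tl e') = false.
  by apply/negP => /eqP eq; rewrite eq adj_irr in adjE'.
(* [T w] says that [w] completes [e] to a triangle. Apart from the side [e] itself, [w] must be the
   end of [e'] that is not shared with [e], which leaves four cases. *)
have -> : \sum_w tri_entry (tl e) (hd e) w e' =
   (ntri adj e)%:R * arc_coef (val e') (tl e) (hd e) +
   ((tl e' == hd e)%:R * (T (hd e'))%:R - (hd e' == hd e)%:R * (T (tl e'))%:R)
   + ((hd e' == tl e)%:R * (T (tl e'))%:R - (tl e' == tl e)%:R * (T (hd e'))%:R).
  transitivity (\sum_w ((T w)%:R * arc_coef (val e') (tl e) (hd e) +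
     ((hd e' == w)%:R * ((tl e' == hd e)%:R * (T w)%:R) -
      (tl e' == w)%:R * ((hd e' == hd e)%:R * (T w)%:R)) +
     ((tl e' == w)%:R * ((hd e' == tl e)%:R * (T w)%:R) -
      (hd e' == w)%:R * ((tl e' == tl e)%:R * (T w)%:R)))).
    apply: eq_bigr => w _; rewrite /tri_entry /triangle adjE /= (adj_sym _ w).
    rewrite andbC -/(T w) /tri_coef {2 3}/arc_coef.
    case: e' {adjE' neq_e'} => -[a b] ob; rewrite /tl /hd /= !xpair_eqE -!mulnb !natrM.
    ring.
  rewrite !big_split /= !sumrN !sum_eqM -mulr_suml; congr (_ * _ + _ + _).
  rewrite /ntri -sum1_card natr_sum [RHS]big_mkcond /=.
  by apply: eq_bigr => w _; rewrite inE -/(T w); case: (T w).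
rewrite sum_div_entryM.
have [<-|neq] := eqVneq e e'.
  rewrite /helm_entry eqxx /T !adj_irr !andbF !(eq_sym (tl e) (hd e)) neq_e !eqxx /=.
  have -> : arc_coef (val e) (tl e) (hd e) = 1.
    by rewrite /arc_coef /tl /hd -surjective_pairing eqxx {1}[val e]surjective_pairing
      xpair_eqE [_ == (val e).2]eq_sym neq_e.
  by rewrite PoszD; ring.
have arc0 : arc_coef (val e') (tl e) (hd e) = 0.
  rewrite /arc_coef; have [ee'|_] := eqVneq (val e') (tl e, hd e).
    by case/eqP: neq; apply: val_inj; rewrite ee' /tl /hd -surjective_pairing.
  have [ee'|//] := eqVneq (val e') (hd e, tl e).
  case: Ho => _ [_ /(_ _ _ (valP e))/negP[]].
  by have := valP e'; rewrite ee'.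
have in_triE : in_tri adj e e' =
   [|| (tl e' == hd e) && T (hd e'), (hd e' == hd e) && T (tl e'),
       (hd e' == tl e) && T (tl e') | (tl e' == tl e) && T (hd e')].
  rewrite /in_tri neq /=.
  have val_e' : val e' = (tl e', hd e') by rewrite -surjective_pairing.
  apply/existsP/idP => [[w /andP[/andP[/andP[_ hw] wt]]]|].
    have Tw : T w by rewrite /T wt adj_sym.
    rewrite val_e' !inE !xpair_eqE => /or4P[] /andP[/eqP-> /eqP->];
      by rewrite !eqxx Tw ?orbT.
  case/or4P => /andP[/eqP eq /andP[wt wh]];
    [exists (hd e')|exists (tl e')|exists (tl e')|exists (hd e')];
   by rewrite adjE wt (adj_sym (hd e)) wh !inE val_e' eq !eqxx ?orbT.
rewrite arc0 mulr0 add0r /helm_entry (negPf neq) /headtail /samedir in_triE.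
rewrite !(eq_sym (hd e)) !(eq_sym (tl e)).
(* Six exclusions, one for each pair among the four possible coincidences of ends: at most one
   coincidence holds, since the edges are distinct, not reverse to each other, and not loops. *)
have not_ht : ~~ ((tl e' == tl e) && (hd e' == hd e)).
  apply: contra neq => /andP[/eqP tt /eqP hh].
  by rewrite -val_eqE (surjective_pairing (val e)) (surjective_pairing (val e'))
    -/(tl e) -/(hd e) -tt -hh eqxx.
have not_th : ~~ ((tl e' == hd e) && (hd e' == tl e)).
  apply/negP => /andP[/eqP th /eqP ht].
  case: Ho => _ [_ /(_ _ _ (valP e))/negP[]].
  by have := valP e'; rewrite [val e']surjective_pairing -/(tl e') -/(hd e') th ht.
have not_h : ~~ ((tl e' == hd e) && (hd e' == hd e)).
  by apply/negP => /andP[/eqP th /eqP hh]; rewrite th hh eqxx in neq_e'.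
have not_t : ~~ ((tl e' == tl e) && (hd e' == tl e)).
  by apply/negP => /andP[/eqP tt /eqP ht]; rewrite tt ht eqxx in neq_e'.
have not_tl : ~~ ((tl e' == tl e) && (tl e' == hd e)).
  by apply/negP => /andP[/eqP tt /eqP th]; rewrite -tt -th eqxx in neq_e.
have not_hd : ~~ ((hd e' == tl e) && (hd e' == hd e)).
  by apply/negP => /andP[/eqP tt /eqP th]; rewrite -tt -th eqxx in neq_e.
move: not_ht not_th not_h not_t not_tl not_hd.
by case: (tl e' == tl e); case: (hd e' == hd e); case: (tl e' == hd e);
  case: (hd e' == tl e) => //= _ _ _ _ _ _; case: (T (hd e')); case: (T (tl e')).
Qed.


(** When [u] and [v] are adjacent, exactly one of [(u, v)] and [(v, u)] is an oriented edge. The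
    antisymmetry of [G] makes the result the same in both cases. *)
Lemma sum_arc_coef_oedge u v (G : V * V -> int) :
  (forall q, G (q.2, q.1) = - G q) ->
  \sum_(e : E) arc_coef (val e) u v * G (val e) = (adj u v)%:R * G (u, v).
Proof.
move=> Gopp.
have -> : \sum_(e : E) arc_coef (val e) u v * G (val e) =
    \sum_(q : V * V | o q.1 q.2) arc_coef q u v * G q.
  by rewrite [RHS]big_sub.
transitivity (\sum_(q : V * V) ((u, v) == q)%:R * ((o q.1 q.2)%:R * G q) -
              \sum_(q : V * V) ((v, u) == q)%:R * ((o q.1 q.2)%:R * G q)).
  rewrite -sumrB big_mkcond; apply: eq_bigr => q _.
  rewrite /arc_coef !(eq_sym q).
  by case: (o _ _); rewrite ?mul1r ?mul0r ?mulr0 ?subr0 ?mulrBl.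
rewrite !sum_eqM /= (Gopp (u, v)) mulrN opprK -mulrDl -natrD; congr (_%:R * _).
case: Ho => oA [/(_ u v) Ao oAs]; case: (boolP (adj u v)) => [/Ao|nA].
  by case: (boolP (o u v)) (oAs u v) => [_ /(_ isT)/negPf->|_ _ /= ->].
have -> : o u v = false by apply: contraNF nA; apply: oA.
by have -> : o v u = false by apply: contraNF nA; rewrite adj_sym; apply: oA.
Qed.

Lemma sum_tri_entry_gram u v w u' v' w' :
  \sum_(e : E) tri_entry u v w e * tri_entry u' v' w' e =
  (triangle u v w && triangle u' v' w')%:R *
  (tri_coef (u, v) u' v' w' + tri_coef (v, w) u' v' w' + tri_coef (w, u) u' v' w').
Proof.
pose G (q : V * V) : int := tri_coef q u' v' w'.
have Gopp q : G (q.2, q.1) = - G q.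
  rewrite /G /tri_coef /arc_coef; case: q => a b /=.
  by rewrite !xpair_eqE ![(b == _) && _]andbC; ring.
transitivity ((triangle u v w)%:R * (triangle u' v' w')%:R * \sum_(e : E)
   (arc_coef (val e) u v * G (val e) + arc_coef (val e) v w * G (val e) +
    arc_coef (val e) w u * G (val e))).
  by rewrite mulr_sumr; apply: eq_bigr => e _; rewrite /tri_entry {1}/tri_coef /G; ring.
rewrite !big_split /= !sum_arc_coef_oedge // /G.
case Tuvw: (triangle u v w); rewrite ?mul0r ?mul1r //.
by case/and3P: Tuvw => -> -> ->; rewrite !mul1r.
Qed.

Lemma triangle_neq u v w : triangle u v w -> [/\ u != v, v != w & w != u].
Proof.
by case/and3P => uv vw wu; split; [move: uv|move: vw|move: wu];
  apply: contraTneq => ->; rewrite adj_irr.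
Qed.

Lemma sum_tri_entry_sqr u v w :
  triangle u v w -> \sum_(e : E) tri_entry u v w e * tri_entry u v w e = 3.
Proof.
move=> T; rewrite sum_tri_entry_gram T mul1r.
have [/negPf uv /negPf vw /negPf wu] := triangle_neq T.
rewrite /tri_coef /arc_coef !xpair_eqE !eqxx uv vw wu !(eq_sym v u) !(eq_sym w v) !(eq_sym u w).
by rewrite uv vw wu.
Qed.

(** With at most one common vertex, no side of the first triple is a side of the second in either
    direction, so every [arc_coef] in the Gram sum is zero. *)
Lemma sum_tri_entry_orth u v w u' v' w' :
  triangle u v w ->
  (#|[set u; v; w] :&: [set u'; v'; w']| <= 1)%N ->
  \sum_(e : E) tri_entry u v w e * tri_entry u' v' w' e = 0.
Proof.
move=> T le1; rewrite sum_tri_entry_gram.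
have [uv vw wu] := triangle_neq T.
have arc0 a b c d : a != b -> a \in [set u; v; w] -> b \in [set u; v; w] ->
    c \in [set u'; v'; w'] -> d \in [set u'; v'; w'] -> arc_coef (a, b) c d = 0.
  move=> ab aA bA cB dB.
  have nab : ~ (a \in [set u'; v'; w'] /\ b \in [set u'; v'; w']).
    case=> aB bB; move: le1; rewrite leqNgt => /negP[]; apply/card_gt1P.
    by exists a, b; rewrite ab !in_setI aA bA aB bB.
  have /negPf Ncd : (a, b) != (c, d) by apply/eqP => -[ac bd]; apply: nab; rewrite ac bd.
  have /negPf Ndc : (a, b) != (d, c) by apply/eqP => -[ad bc]; apply: nab; rewrite ad bc.
  by rewrite /arc_coef Ncd Ndc.
by rewrite /tri_coef !arc0 ?addr0 ?mulr0 // ?inE ?eqxx ?orbT.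
Qed.

End Boundary.

(** * The Helmholtzian as a Gram matrix, and its form on a triangle packing *)

Section QuadraticForm.
Local Open Scope sesquilinear_scope.

Lemma gram_form (C : numClosedFieldType) (T : finType) n (F : T -> 'rV[C]_n) (u : 'rV_n) :
  (forall y, F y \is a mxOver Num.real) ->
  (u *m (\sum_y (F y)^T *m F y) *m u^t*) 0 0 = \sum_y `|(u *m (F y)^T) 0 0| ^+ 2.
Proof.
move=> Freal; rewrite mulmx_sumr mulmx_suml summxE; apply: eq_bigr => y _.
rewrite !mulmxA -mulmxA.
(* As [F y] is real, this factor is the conjugate of the other one. *)
have -> : F y *m u^t* = (u *m (F y)^T)^t*.
  by rewrite trmx_mul trmxK map_mxM; congr (_ *m _); rewrite -[LHS](realmxC (Freal y)).
by rewrite mxE big_ord1 !mxE normCK.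
Qed.

Lemma ler_sum_sub (R : numDomainType) (T : finType) (P Q : pred T) (F : T -> R) :
  subpred P Q -> (forall x, 0 <= F x) -> \sum_(x | P x) F x <= \sum_(x | Q x) F x.
Proof.
move=> sPQ F0; rewrite [leRHS](bigID P) /=.
rewrite (eq_bigl P) ?lerDl ?sumr_ge0 // => x.
by apply/andP/idP => [[]//|Px]; rewrite sPQ.
Qed.

Definition verts (V : finType) (y : V * V * V) : {set V} := [set y.1.1; y.1.2; y.2].

(** [F] takes one value on the six orderings of [y i], and distinct vertex sets keep the orderings
    for different [i] apart. This absorbs the factor [6^-1] of [helmholtzian_gram]. *)
Lemma sum_triples_ge (R : numDomainType) (V : finType) m (y : 'I_m -> V * V * V)
    (F : V * V * V -> R) :
  (forall z, 0 <= F z) ->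
  (forall u v w, F (v, w, u) = F (u, v, w)) ->
  (forall u v w, F (v, u, w) = F (u, v, w)) ->
  (forall i, #|verts (y i)| = 3%N) ->
  injective (fun i => verts (y i)) ->
  6 * \sum_i F (y i) <= \sum_z F z.
Proof.
move=> F0 Fcycle Fswap y3 yinj.
(* Group the triples by vertex set: each [z] belongs to the group of at most one [i]. *)
apply: (@le_trans _ _ (\sum_i \sum_(z | verts z == verts (y i)) F z)); last first.
  rewrite (exchange_big_dep xpredT) //=; apply: ler_sum => z _.
  have [i /eqP zi|nz] := pickP (fun i => verts z == verts (y i)).
    rewrite (big_pred1 i) // => j /=; rewrite zi.
    by apply/eqP/eqP => [/yinj->|->].
  by rewrite big_pred0.
rewrite mulr_sumr; apply: ler_sum => i _.
move: (y3 i); case: (y i) => -[u v] w; rewrite /verts /= => c3.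
have [uv uw vw] : [/\ u != v, u != w & v != w].
  move: c3; rewrite -setUA cardsU1 cards2 !inE.
  by case: (u == v); case: (u == w); case: (v == w).
pose r := [:: (u, v, w); (v, w, u); (w, u, v); (v, u, w); (u, w, v); (w, v, u)].
have Ur : uniq r.
  rewrite /= !inE !xpair_eqE !eqxx !(eq_sym v u) !(eq_sym w u) !(eq_sym w v).
  by rewrite (negPf uv) (negPf uw) (negPf vw).
have -> : 6 * F (u, v, w) = \sum_(z <- r) F z.
  rewrite !big_cons big_nil (Fcycle u w v) (Fcycle v u w) (Fswap u v w) (Fcycle u v w).
  rewrite -(Fcycle w u v).
  ring.
rewrite big_uniq //; apply: ler_sum_sub => // z.
rewrite !inE => /or4P[| | |/or3P[| |]] /eqP-> /=; apply/eqP/setP => x; rewrite !inE /=;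
 by case: (x == u); case: (x == v); case: (x == w).
Qed.

Variables (V : finType) (adj o : rel V).
Hypotheses (Hg : simple_graph adj) (Ho : orientation adj o).
Local Notation n := #|{: oedge o}|.

Definition div_row (v : V) : 'rV[algC]_n := \row_i (div_entry v (enum_val i))%:~R.

Definition tri_row (y : V * V * V) : 'rV[algC]_n :=
  \row_i (tri_entry adj y.1.1 y.1.2 y.2 (enum_val i))%:~R.

Lemma div_row_real v : div_row v \is a mxOver Num.real.
Proof. by apply/mxOverP => i j; rewrite mxE realz. Qed.

Lemma tri_row_real y : tri_row y \is a mxOver Num.real.
Proof. by apply/mxOverP => i j; rewrite mxE realz. Qed.

(** The factor [6^-1] compensates for summing over ordered triples, where each triangle occurs six
    times. *)
Lemma helmholtzian_gram : helmholtzian adj o =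
  \sum_v (div_row v)^T *m div_row v + 6^-1 *: \sum_y (tri_row y)^T *m tri_row y.
Proof.
apply/matrixP => i j; rewrite !mxE !summxE helm_entryE // rmorphD /= rmorph_sum /=.
congr (_ + _).
  by apply: eq_bigr => v _; rewrite mxE big_ord1 !mxE rmorphM.
apply: (mulfI (_ : 6 != 0)); first by rewrite pnatr_eq0.
rewrite mulVKf ?pnatr_eq0 //.
have := sum_tri_entryM Hg (enum_val i) (enum_val j).
move/(congr1 (fun z : int => z%:~R : algC)); rewrite rmorphM /= => <-.
rewrite !pair_big rmorph_sum; apply: eq_bigr => y _.
by rewrite mxE big_ord1 !mxE rmorphM.
Qed.

Lemma helmholtzian_hermitian : helmholtzian adj o \is hermsymmx.
Proof.
apply: realsym_hermsym; last by apply/mxOverP => i j; rewrite mxE realz.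
rewrite is_hermitianmxE expr0 scale1r map_mx_id // helmholtzian_gram.
rewrite linearD linearZ /= !raddf_sum /=; apply/eqP; congr (_ + _);
  by apply: eq_bigr => y _; rewrite trmx_mul trmxK.
Qed.

Lemma packing_le_count m (y : 'I_m -> V * V * V) (rs : seq algC) :
  (forall i, triangle adj (y i).1.1 (y i).1.2 (y i).2) ->
  (forall i j, i != j -> (#|verts (y i) :&: verts (y j)| <= 1)%N) ->
  char_poly (helmholtzian adj o) = \prod_(r <- rs) ('X - r%:P) ->
  (m <= count (fun r => (3 <= r)%R) rs)%N.
Proof.
move=> tri_y disj charH.
have card3 i : #|verts (y i)| = 3%N.
  have [uv vw wu] := triangle_neq Hg (tri_y i).
  by rewrite /verts -setUA cardsU1 cards2 !inE negb_or uv vw eq_sym wu.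
have verts_inj : injective (fun i => verts (y i)).
  move=> i j /= eqij; apply/eqP; apply: contraT => /disj.
  by rewrite -eqij setIid card3.
pose W : 'M[algC]_(m, n) := \matrix_(i, j) tri_row (y i) 0 j.
(* Orthogonality of the packed triangle vectors, each of squared norm 3. It gives the freeness of
   [W], the norm of [u = a W] and its products with the rows. *)
have WW : W *m W^T = 3%:M.
  apply/matrixP => i j; rewrite !mxE.
  transitivity ((\sum_(e : oedge o) tri_entry adj (y i).1.1 (y i).1.2 (y i).2 e *
      tri_entry adj (y j).1.1 (y j).1.2 (y j).2 e)%:~R : algC).
    rewrite rmorph_sum [RHS](reindex _ (onW_bij _ (@enum_val_bij _))) /=.
    by apply: eq_bigr => e _; rewrite !mxE intrM.
  have [<-|ij] := eqVneq i j; first by rewrite sum_tri_entry_sqr.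
  by rewrite sum_tri_entry_orth // disj.
have Wreal : W \is a mxOver Num.real by apply/mxOverP => i j; rewrite !mxE realz.
have three0 : (3 : algC) != 0 by rewrite pnatr_eq0.
apply: (leq_count_eigenvalue_ge (W := W) _ helmholtzian_hermitian _ _ charH).
- exact: ger0_real.
- apply: inj_row_free => a aW0; apply: (scalerI three0).
  by rewrite -mul_mx_scalar -WW mulmxA aW0 mul0mx scaler0.
move=> u /submxP[a defu].
rewrite helmholtzian_gram mulmxDr mulmxDl [leRHS]mxE.
rewrite -scalemxAr -scalemxAl [X in _ + X]mxE !gram_form;
  [|exact: tri_row_real|exact: div_row_real].
(* Drop the nonnegative incidence squares and keep only the triangles of the packing. *)
apply: (@le_trans _ _ (\sum_i `|(u *m (tri_row (y i))^T) 0 0| ^+ 2)); last first.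
  apply: ler_wpDl; first by apply: sumr_ge0 => v _; rewrite exprn_ge0.
  rewrite ler_pdivlMl //.
  apply: (sum_triples_ge (F := fun z => `|(u *m (tri_row z)^T) 0 0| ^+ 2)) => //.
  - by move=> z; rewrite exprn_ge0.
  - move=> v1 v2 v3; congr (`|(u *m _^T) 0 0| ^+ 2).
    by apply/rowP => j; rewrite !mxE tri_entry_cycle.
  - move=> v1 v2 v3; rewrite -(normrN (_ 0 0)); congr (`|_| ^+ 2).
    rewrite !mxE -sumrN; apply: eq_bigr => j _.
    by rewrite !mxE /= tri_entry_swap // rmorphN mulrN opprK.
have uW i : (u *m (tri_row (y i))^T) 0 0 = 3 * a 0 i.
  transitivity ((u *m W^T) 0 i).
    by rewrite !mxE; apply: eq_bigr => j _; rewrite !mxE.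
  by rewrite defu -mulmxA WW mul_mx_scalar mxE.
have -> : (u *m u^t*) 0 0 = 3 * \sum_i `|a 0 i| ^+ 2.
  rewrite defu trmx_mul map_mxM mulmxA -(mulmxA a).
  have -> : W^t* = W^T by apply: realmxC; apply/mxOverP => i j; rewrite !mxE realz.
  rewrite WW mul_mx_scalar -scalemxAl mxE; congr (_ * _).
  by rewrite mxE; apply: eq_bigr => i _; rewrite !mxE normCK.
rewrite mulrA mulr_sumr ler_sum // => i _.
by rewrite uW normrM normr_nat exprMn expr2.
Qed.

End QuadraticForm.

(** * From triples in cliques to the final count *)

Lemma clique_triangle (V : finType) (adj : rel V) (S A : {set V}) :
  is_clique adj S -> A \subset S -> #|A| = 3%N ->
  exists y : V * V * V, verts y = A /\ triangle adj y.1.1 y.1.2 y.2.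
Proof.
move=> clS /subsetP sAS cA.
have [w wA] : exists w, w \in A by apply/set0Pn; rewrite -cards_eq0 cA.
have /eqP/cards2P[u [v [uv Aw]]] : #|A :\ w| = 2%N.
  by move: cA; rewrite (cardsD1 w) wA => -[].
have : v \in A :\ w by rewrite Aw set22.
have : u \in A :\ w by rewrite Aw set21.
rewrite !inE => /andP[uw uA] /andP[vw vA].
exists (u, v, w); split; first by rewrite /verts /= setUC -Aw setD1K.
by rewrite /triangle /= !clS ?sAS // eq_sym.
Qed.

Theorem theorem5p8 (V : finType) (adj o : rel V)
  (Hg : simple_graph adj) (Ho : orientation adj o)
  (k : nat) (S : 'I_k -> {set V})
  (Hcl : forall i, is_clique adj (S i))
  (Hs : forall i, (3 <= #|S i|)%N)
  (Hdisj : forall i j, i != j -> (#|S i :&: S j| <= 1)%N)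
  (rs : seq algC)
  (Hrs : char_poly (helmholtzian adj o) = \prod_(r <- rs) ('X - r%:P)) :
  \sum_(i < k) ('C(#|S i|, 3)%:R / (1 + 3 * (#|S i| - 3)%N%:R) : algC)
    <= (count (fun r => 3 <= r) rs)%:R.
Proof.
have [P PS] := fin_all_exists (fun i => ex_triple_packing (S i)).
pose Q := \bigcup_i P i.
have PSsub i A : A \in P i -> A \subset S i /\ #|A| = 3%N by case: (PS i) => + _ _; apply.
(* Triples from different cliques inherit the bound on the intersection of the cliques. As a triple
   meets itself in three points, the families [P i] are also disjoint, and their sizes add up. *)
have Pcross i j A B : i != j -> A \in P i -> B \in P j -> (#|A :&: B| <= 1)%N.
  move=> ij /PSsub[sA _] /PSsub[sB _].
  by apply: leq_trans (Hdisj i j ij); rewrite subset_leq_card // setISS.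
have cardQ : #|Q| = (\sum_i #|P i|)%N.
  rewrite -sum1_card partition_disjoint_bigcup => [|i j ij].
    by apply: eq_bigr => i _; rewrite sum1_card.
  rewrite -setI_eq0; apply/eqP/setP => A; rewrite !inE; apply/andP => -[Ai Aj].
  by have := Pcross i j A A ij Ai Aj; rewrite setIid (PSsub i A Ai).2.
have Qdisj A B : A \in Q -> B \in Q -> A != B -> (#|A :&: B| <= 1)%N.
  move=> /bigcupP[i _ Ai] /bigcupP[j _ Bj] AB.
  have [ij|ij] := eqVneq i j; last exact: (Pcross i j).
  by case: (PS i) => _ + _; apply; rewrite // ij.
have [y yE] : exists y : 'I_#|Q| -> V * V * V, forall t,
    verts (y t) = enum_val t /\ triangle adj (y t).1.1 (y t).1.2 (y t).2.
  apply: (fin_all_exists (P := fun t y => verts y = enum_val t /\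
     triangle adj y.1.1 y.1.2 y.2)) => t.
  have /bigcupP[i _ /PSsub[sA cA]] := enum_valP t.
  exact: clique_triangle (Hcl i) sA cA.
have : (#|Q| <= count (fun r => (3 <= r)%R) rs)%N.
  apply: (packing_le_count Hg Ho (y := y)) => // [t|s t st]; first by case: (yE t).
  rewrite (yE s).1 (yE t).1; apply: Qdisj (enum_valP s) (enum_valP t) _.
  by rewrite (inj_eq enum_val_inj).
rewrite -(ler_nat algC); apply: le_trans; rewrite cardQ natr_sum.
(* Clearing the positive denominator turns each summand into the size bound of the packing [P i]. *)
apply: ler_sum => i _; rewrite -natrM nat1r ler_pdivrMr ?ltr0n // -natrM ler_nat.
by case: (PS i).
Qed.
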